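(* Let $n\ge 2$, $r\ge 1$ and let $a:\mathbb{N}\to\,]0,+\infty[$ be a fixed function. There is a real constant $c$ such that the $\mathcal{M}^{(a)}_{n,r}$-model, i.e. the distribution $$p^*(\mathbf{x})=\frac{\prod_{j=1}^n a(x_j)}{\sum_{\boldsymbol{\eta}\in A_{n,r}}\prod_{j=1}^n a(\eta_j)},\qquad \mathbf{x}\in A_{n,r},$$ is a solution of the maximum entropy problem: maximize $-\sum_{\mathbf{x}\in A_{n,r}}p(\mathbf{x})\log p(\mathbf{x})$ over functions $p:A_{n,r}\to\mathbb{R}$ subject to $$p(\mathbf{x})\ge 0\ \text{ for every }\mathbf{x}\in A_{n,r},\qquad \sum_{\mathbf{x}\in A_{n,r}}p(\mathbf{x})=1,\qquad \sum_{\mathbf{x}\in A_{n,r}}\log\Big(\prod_{j=1}^n a(x_j)\Big)\,p(\mathbf{x})=c .$$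
   Context: $\mathbb{N}=\{0,1,2,\dots\}$, and $A_{n,r}=\{\mathbf{x}=(x_1,\dots,x_n): x_j\in\{0,1,\dots,r\},\ \sum_{j=1}^n x_j=r\}$. The convention $0\log 0=0$ is used. A solution of the problem is a feasible $p$ attaining the maximum. *)

(* Defs.v *)
From mathcomp Require Import all_boot all_order all_algebra.
From mathcomp Require Import reals exp.

Set Implicit Arguments.
Unset Strict Implicit.
Unset Printing Implicit Defensive.

Import Order.TTheory GRing.Theory Num.Theory.

Local Open Scope ring_scope.

(** [A n r] is A_{n,r}: the x in {0, ..., r}^n whose coordinates sum to r. *)
Definition A (n r : nat) : predArgType :=
  {x : {ffun 'I_n -> 'I_r.+1} | (\sum_(j < n) x j == r)%N}.

Section MaximumEntropy.
Context {R : realType} {n r : nat}.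
Implicit Types (a : nat -> R) (c : R) (p : A n r -> R).

Definition weight a (x : A n r) : R := \prod_(j < n) a (val x j).

(** The distribution of the M^(a)_{n,r}-model. *)
Definition Mmodel a (x : A n r) : R :=
  weight a x / \sum_(eta : A n r) weight a eta.

(** [ln 0 = 0] in the library, so the convention 0 log 0 = 0 holds. *)
Definition entropy p : R := - \sum_(x : A n r) p x * ln (p x).

Definition feasible a c p : Prop :=
  [/\ forall x, 0 <= p x,
      \sum_(x : A n r) p x = 1
    & \sum_(x : A n r) ln (weight a x) * p x = c].

Definition max_entropy_solution a c p : Prop :=
  feasible a c p /\ forall q, feasible a c q -> entropy q <= entropy p.

End MaximumEntropy.

(* Main.v *)
(** Gibbs' inequality bounds the entropy of any distribution [q] by the cross
    entropy [- \sum q * ln p*]. Since [ln p*] is [ln (weight a)] up to an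
    additive constant, this cross entropy takes the same value on all [q]
    satisfying the constraints, in particular on [p*] itself when [c] is the
    mean of [ln (weight a)] under [p*]. *)
Require Import Defs.
From mathcomp Require Import all_boot all_order all_algebra.
From mathcomp Require Import reals exp.

Import Order.TTheory GRing.Theory Num.Theory.

Local Open Scope ring_scope.

(** For [x > 0] this is [ln t <= t - 1] at [t = y / x], multiplied by [x]; at [x = 0] the left side
    vanishes. *)
Lemma mulr_lnB_le (R : realType) (x y : R) :
  0 <= x -> 0 < y -> x * ln y - x * ln x <= y - x.
Proof.
move=> x_ge0 y_gt0; have [->|x_neq0] := eqVneq x 0.
  by rewrite !mul0r !subr0 ltW.
have x_gt0 : 0 < x by rewrite lt_def x_neq0.
have yx_gt0 : 0 < y / x by rewrite divr_gt0.
rewrite -mulrBr -ln_div ?posrE//.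
have -> : y - x = x * (y / x - 1) by rewrite mulrBr mulr1 mulrC divfK.
rewrite ler_pM2l// -[X in ln X](subrK 1) addrC.
by rewrite le_ln1Dx// ltrBrDr addNr.
Qed.

Lemma gibbs_inequality (R : realType) (T : finType) (p q : T -> R) :
    (forall x, 0 <= p x) -> (forall x, 0 < q x) ->
    \sum_x p x = \sum_x q x ->
  - \sum_x p x * ln (p x) <= - \sum_x p x * ln (q x).
Proof.
move=> p_ge0 q_gt0 eq_pq; rewrite lerN2 -subr_le0 -sumrB.
(* The pointwise bounds sum to a difference of total masses, which is zero. *)
apply: (@le_trans _ _ (\sum_x (q x - p x))); last by rewrite sumrB eq_pq subrr.
by apply: ler_sum => x _; exact: mulr_lnB_le.
Qed.

Lemma A_inhabited (n r : nat) : (0 < n)%N -> A n r.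
Proof.
case: n => // n _.
(* The point $(r, 0, \dots, 0)$; some point is needed for the normalising sum to be positive. *)
pose x := [ffun j : 'I_n.+1 => if j == ord0 then ord_max else ord0 : 'I_r.+1].
suff x_sum : (\sum_(j < n.+1) x j == r)%N by exists x.
rewrite big_ord_recl big1 => [|j _]; last by rewrite ffunE.
by rewrite ffunE addn0.
Qed.

Section Mmodel.
Variables (R : realType) (n r : nat) (a : nat -> R).
Hypotheses (n_gt0 : (0 < n)%N) (a_gt0 : forall k, 0 < a k).

Lemma weight_gt0 (x : A n r) : 0 < weight a x.
Proof. by apply: prodr_gt0. Qed.

Lemma sum_weight_gt0 : 0 < \sum_(x : A n r) weight a x.
Proof.
rewrite (bigD1 (A_inhabited n r n_gt0))//= ltr_pwDl ?weight_gt0//.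
by apply: sumr_ge0 => x _; rewrite ltW ?weight_gt0.
Qed.

Lemma Mmodel_gt0 (x : A n r) : 0 < Mmodel a x.
Proof. by rewrite divr_gt0 ?weight_gt0 ?sum_weight_gt0. Qed.

Lemma sum_Mmodel : \sum_(x : A n r) Mmodel a x = 1.
Proof. by rewrite -mulr_suml divff ?gt_eqF ?sum_weight_gt0. Qed.

Lemma cross_entropy_Mmodel (c : R) (q : A n r -> R) : feasible a c q ->
  \sum_(x : A n r) q x * ln (Mmodel a x)
    = c - ln (\sum_(x : A n r) weight a x).
Proof.
(* The log of the normalising sum is written as itself times [\sum_x q x = 1], so that both sides
   compare termwise. *)
case=> _ q_sum q_mean; rewrite -q_mean -[X in _ = _ - X]mul1r -q_sum.
rewrite mulr_suml -sumrB; apply: eq_bigr => x _.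
by rewrite ln_div ?posrE ?weight_gt0 ?sum_weight_gt0// mulrBr [ln _ * _]mulrC.
Qed.

End Mmodel.

Theorem proposition4p2 (R : realType) (n r : nat) (a : nat -> R)
    (hn : (2 <= n)%N) (hr : (1 <= r)%N) (ha : forall k : nat, 0 < a k) :
  exists c : R, max_entropy_solution a c (Mmodel a : A n r -> R).
Proof.
have n_gt0 : (0 < n)%N by exact: ltnW.
exists (\sum_(x : A n r) ln (weight a x) * Mmodel a x).
have feasM : feasible a (\sum_(x : A n r) ln (weight a x) * Mmodel a x)
                      (Mmodel a : A n r -> R).
  by split=> // [x|]; [rewrite ltW// Mmodel_gt0 | exact: sum_Mmodel].
split=> // q feasq; have [q_ge0 q_sum _] := feasq.
(* The entropy of [Mmodel a] is its cross entropy with itself, so it can be exchanged for that of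
   [q] relative to [Mmodel a]. *)
rewrite /entropy (cross_entropy_Mmodel _ _ _ _ n_gt0 ha _ _ feasM).
rewrite -(cross_entropy_Mmodel _ _ _ _ n_gt0 ha _ _ feasq).
apply: gibbs_inequality => // [x|]; first exact: Mmodel_gt0.
by rewrite q_sum sum_Mmodel.
Qed.
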